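(* Let $F\le F'\le\mathrm{Sym}(\Omega)$. Then $F$ has distinct point stabilisers if and only if the set of uniscalar elements in $G(F,F')$ is equal to the set of elliptic elements in $G(F,F')$.
   Context: **Tree and groups.** $T$ is a locally finite regular (undirected, simple) tree with vertex set $V(T)$, edge set $E(T)\subset V(T)\times V(T)$ (each edge occurs as $(u,v)$ and as $(v,u)=\overline{(u,v)}$); $E(v)$ is the set of edges with origin $v$. $\Omega=\{0,\dots,\deg(T)-1\}$. Fix a legal colouring $c:E(T)\to\Omega$, i.e. $c(e)=c(\bar e)$ for all $e$ and $c|_{E(v)}:E(v)\to\Omega$ is a bijection for each $v$. For $g\in\mathrm{Aut}(T)$, $v\in V(T)$, the local action is $\sigma(g,v)=c\circ g\circ (c|_{E(v)})^{-1}\in\mathrm{Sym}(\Omega)$. For $F\le\mathrm{Sym}(\Omega)$, $U(F)=\{g\in\mathrm{Aut}(T):\sigma(g,v)\in F\ \forall v\in V(T)\}$ with the permutation topology. For $F\le F'\le\mathrm{Sym}(\Omega)$, $G(F,F')=\{g\in U(F'):\sigma(g,v)\in F\text{ for all but finitely many }v\}$, with the unique group topology making the inclusion $U(F)\to G(F,F')$ continuous and open; it is a totally disconnected locally compact (t.d.l.c.) group. $g\in\mathrm{Aut}(T)$ is elliptic if it preserves some non-empty finite set of vertices. **Scale.** For a t.d.l.c. group $G$ and $g\in G$, $s(g)=\min\{[gUg^{-1}:gUg^{-1}\cap U]: U\le G\text{ compact open}\}$. An element $g$ is uniscalar if $s(g)=1=s(g^{-1})$. **Distinct point stabilisers.**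 $F\le\mathrm{Sym}(\Omega)$ has distinct point stabilisers if for all $a,b\in\Omega$, $F_a=F_b$ if and only if $a=b$, where $F_a$ is the stabiliser of $a$ in $F$. *)

(* Defs.v *)
From HB Require Import structures.
From mathcomp Require Import all_boot fingroup perm action.
From mathcomp Require Import all_classical topology.

Set Implicit Arguments.
Unset Strict Implicit.
Unset Printing Implicit Defensive.

Local Open Scope classical_set_scope.
Local Open Scope card_scope.
Local Open Scope group_scope.

HB.mixin Record isTopologicalGroup G of Topological G & monoid.Group G := {
  mulg_continuous : continuous (fun x : G * G => x.1 * x.2);
  invg_continuous : continuous (fun x : G => x^-1)
}.

#[short(type="topGroupType")]
HB.structure Definition TopologicalGroup :=
  {G of Topological G & monoid.Group G & isTopologicalGroup G}.

Section Scale.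
Variable G : topGroupType.
Implicit Types (g : G) (H K U : set G) (n : nat).

Definition is_subgroup U :=
  [/\ U 1, forall x y, U x -> U y -> U (x * y) & forall x, U x -> U x^-1].

(* [g U g^-1]; the library's [x ^ y] is [y^-1 * x * y] *)
Definition conjugate g U : set G := [set g * u * g^-1 | u in U].

Definition left_cosets H K : set (set G) := [set [set h * k | k in K] | h in H].

Definition scale_indices g : set nat := [set n | exists U,
  [/\ is_subgroup U, compact U, open U
    & left_cosets (conjugate g U) (conjugate g U `&` U) #= `I_n]].

(* The index of an open subgroup in a compact group is finite, so that every
   compact open subgroup contributes to [scale_indices g]. The default value 0
   is only taken when [G] has no compact open subgroup, which is impossible for
   a t.d.l.c. group. *)
Definition scale g : nat := xget 0%N
  [set n | scale_indices g n /\ forall m, scale_indices g m -> (n <= m)%N].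

Definition uniscalar g := scale g = 1%N /\ scale g^-1 = 1%N.

End Scale.

Record regTree (d : nat) := RegTree {
  vertex :> choiceType;
  adj : rel vertex;
  adj_sym : symmetric adj;
  adj_irr : irreflexive adj;
  tree_nonempty : inhabited vertex;
  tree_connected : forall u v, exists2 p, path adj u p & last u p = v;
  (* an edge run back and forth is an [adj]-cycle of size 2 *)
  tree_acyclic : forall s, ucycle adj s -> (size s <= 2)%N;
  tree_regular : forall v, [set w | adj v w] #= `I_d
}.

Section Tree.
Variables (d : nat) (T : regTree d).

Definition edge := {e : T * T | adj e.1 e.2}.

Definition origin (e : edge) : T := (sval e).1.
Definition terminus (e : edge) : T := (sval e).2.

Lemma adj_rev (e : edge) : adj (terminus e) (origin e).
Proof. by rewrite adj_sym; exact: svalP e. Qed.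

Definition rev_edge (e : edge) : edge :=
  exist _ (terminus e, origin e) (adj_rev e).

Record colouring := Colouring {
  col :> edge -> 'I_d;
  col_rev : forall e, col (rev_edge e) = col e;
  col_bij : forall v, set_bij [set e | origin e = v] setT col
}.

Record aut := Aut {
  aut_fun :> T -> T;
  aut_bij : bijective aut_fun;
  aut_adj : forall u v, adj (aut_fun u) (aut_fun v) = adj u v
}.

HB.instance Definition _ := gen_eqMixin aut.
HB.instance Definition _ := gen_choiceMixin aut.

Lemma autP (g h : aut) : g =1 h -> g = h.
Proof.
case: g h => [g gb ga] [h hb ha] /= /funext gh.
by subst h; congr Aut; exact: Prop_irrelevance.
Qed.

Definition aut_one : aut := 
  @Aut id (Bijective (fun=> erefl) (fun=> erefl)) (fun _ _ => erefl).

Lemma aut_mul_adj (g h : aut) u v : adj ((g \o h) u) ((g \o h) v) = adj u v.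
Proof. by rewrite /= !aut_adj. Qed.

Definition aut_mul (g h : aut) : aut :=
  Aut (bij_comp (aut_bij g) (aut_bij h)) (@aut_mul_adj g h).

Lemma aut_surj (g : aut) w : exists v, g v = w.
Proof. by have [k _ gk] := aut_bij g; exists (k w). Qed.

Definition aut_inv_fun (g : aut) w := sval (cid (aut_surj g w)).

Lemma aut_funK (g : aut) : cancel (aut_inv_fun g) g.
Proof. by move=> w; rewrite /aut_inv_fun; case: cid. Qed.

Lemma aut_inv_funK (g : aut) : cancel g (aut_inv_fun g).
Proof. by move=> v; apply: (bij_inj (aut_bij g)); rewrite aut_funK. Qed.

Lemma aut_inv_adj (g : aut) u v :
  adj (aut_inv_fun g u) (aut_inv_fun g v) = adj u v.
Proof. by rewrite -(aut_adj g) !aut_funK. Qed.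

Definition aut_inv (g : aut) : aut :=
  Aut (Bijective (aut_funK g) (aut_inv_funK g)) (@aut_inv_adj g).

Lemma aut_mulA : associative aut_mul. Proof. by move=> *; apply: autP. Qed.
Lemma aut_mul1 : left_id aut_one aut_mul. Proof. by move=> *; apply: autP. Qed.
Lemma aut_mulr1 : right_id aut_one aut_mul.
Proof. by move=> *; apply: autP. Qed.
Lemma aut_mulV : left_inverse aut_one aut_inv aut_mul.
Proof. by move=> g; apply: autP => v /=; rewrite aut_inv_funK. Qed.
Lemma aut_mulrV : right_inverse aut_one aut_inv aut_mul.
Proof. by move=> g; apply: autP => v /=; rewrite aut_funK. Qed.

HB.instance Definition _ :=
  isGroup.Build aut aut_mulA aut_mul1 aut_mulr1 aut_mulV aut_mulrV.

Lemma autM (g h : aut) v : (g * h) v = g (h v). Proof. by []. Qed.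
Lemma aut1 v : (1 : aut) v = v. Proof. by []. Qed.
Lemma autVK (g : aut) v : g (g^-1 v) = v. Proof. exact: aut_funK. Qed.
Lemma autKV (g : aut) v : g^-1 (g v) = v. Proof. exact: aut_inv_funK. Qed.

(* The permutation topology on [Aut(T)]: the basic neighbourhoods of [g] are the
   sets of all [h] that agree with [g] on a given finite set of vertices. *)
Definition perm_open (W : set aut) := forall g, W g ->
  exists2 B : set T, finite_set B &
    forall h : aut, (forall v, B v -> h v = g v) -> W h.

Lemma perm_openT : perm_open setT.
Proof. by move=> g _; exists set0 => //; exact: finite_set0. Qed.

Lemma perm_openI : setI_closed perm_open.
Proof.
move=> W1 W2 o1 o2 g [/o1[B1 f1 H1] /o2[B2 f2 H2]].
exists (B1 `|` B2); first by rewrite finite_setU.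
by move=> h e; split; [apply: H1|apply: H2] => v Bv; apply: e; [left|right].
Qed.

Lemma perm_open_bigU (I : Type) (f : I -> set aut) :
  (forall i, perm_open (f i)) -> perm_open (\bigcup_i f i).
Proof.
move=> o g [i _ /o[B fB H]]; exists B => // h /H Wh; by exists i.
Qed.

HB.instance Definition _ :=
  isOpenTopological.Build aut perm_openT perm_openI perm_open_bigU.

Lemma aut_openE (W : set aut) : open W = perm_open W. Proof. by []. Qed.

Definition elliptic (g : aut) :=
  exists A : set T, [/\ finite_set A, A !=set0 & g @` A = A].

Lemma aut_edge_adj (g : aut) (e : edge) : adj (g (origin e)) (g (terminus e)).
Proof. by rewrite aut_adj; exact: svalP e. Qed.

Definition aut_edge (g : aut) (e : edge) : edge :=
  exist _ (g (origin e), g (terminus e)) (aut_edge_adj g e).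

Section LocalAction.
Variable c : colouring.

Lemma col_surj v a : exists2 e, origin e = v & c e = a.
Proof. by have [_ _ /(_ a I)[e]] := col_bij c v; exists e. Qed.

(* the inverse of the bijection [c] from the edges with origin [v] to colours *)
Definition col_inv v a : edge := sval (cid2 (col_surj v a)).

Lemma col_inj e e' : origin e = origin e' -> c e = c e' -> e = e'.
Proof.
move=> oe ce; have [_ inj _] := col_bij c (origin e').
by apply: inj ce; rewrite inE /=.
Qed.

Lemma origin_col_inv v a : origin (col_inv v a) = v.
Proof. by rewrite /col_inv; case: cid2. Qed.

Lemma col_invK v a : c (col_inv v a) = a.
Proof. by rewrite /col_inv; case: cid2. Qed.

Lemma aut_edge_inj g : injective (aut_edge g).
Proof.
move=> [[u v] e] [[u' v'] e'] [] /(bij_inj (aut_bij g)) + /(bij_inj (aut_bij g)).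
by rewrite /origin /terminus /= => ? ?; subst; congr exist; exact: Prop_irrelevance.
Qed.

Lemma local_action_inj (g : aut) v :
  injective (fun a => c (aut_edge g (col_inv v a))).
Proof.
move=> a b /col_inj eab; rewrite -(col_invK v a) -(col_invK v b); congr (c _).
by apply: (@aut_edge_inj g); apply: eab; rewrite /origin /= -!/(origin _) !origin_col_inv.
Qed.

Definition local_action (g : aut) (v : T) : 'S_d := perm (@local_action_inj g v).

Lemma local_actionE (g : aut) e : local_action g (origin e) (c e) = c (aut_edge g e).
Proof.
rewrite permE; congr (c (aut_edge g _)).
by apply: col_inj; rewrite ?origin_col_inv ?col_invK.
Qed.

Lemma local_actionP (g : aut) v (s : 'S_d) :
  (forall e, origin e = v -> s (c e) = c (aut_edge g e)) -> local_action g v = s.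
Proof.
move=> H; apply/permP => a; have [e oe <-] := col_surj v a.
by rewrite -{1}oe local_actionE H.
Qed.

Lemma local_action1 v : local_action 1 v = 1.
Proof.
apply: local_actionP => e _; rewrite perm1; congr (c _).
by case: e => [[x y] xy]; congr exist; exact: Prop_irrelevance.
Qed.

(* Products in ['S_d] are composed from left to right. *)
Lemma local_actionM (g h : aut) v :
  local_action (g * h) v = local_action h v * local_action g (h v).
Proof.
apply: local_actionP => e <-; rewrite permM local_actionE.
rewrite -[h (origin e)]/(origin (aut_edge h e)) local_actionE; congr (c _).
by congr exist; exact: Prop_irrelevance.
Qed.

Lemma local_actionV (g : aut) v : local_action g^-1 v = (local_action g (g^-1 v))^-1.
Proof.
have := local_actionM g g^-1 v; rewrite mulgV local_action1 => /esym/eqP.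
by rewrite -eq_invg_mul => /eqP <-; rewrite invgK.
Qed.

Lemma local_action_fix (g : aut) v : g v = v -> (forall w, adj v w -> g w = w) ->
  local_action g v = 1.
Proof.
move=> gv gw; apply: local_actionP => e oe; rewrite perm1; congr (c _).
case: e oe => [[x y] xy]; rewrite /origin /= => xv; subst x.
apply/eqP; rewrite -val_eqE; apply/eqP => /=.
by rewrite /origin/terminus /= gv gw.
Qed.

Definition U_set (F : {group 'S_d}) : set aut :=
  [set g | forall v, local_action g v \in F].

Definition G_set (F F' : {group 'S_d}) : set aut :=
  [set g | U_set F' g /\ finite_set [set v | local_action g v \notin F]].

Lemma U_group_closed F : group_closed (fun g => g \in U_set F).
Proof.
split; first by rewrite inE => v; rewrite local_action1 group1.
move=> g h /set_mem Ug /set_mem Uh; rewrite inE => v.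
by rewrite local_actionM local_actionV groupM // groupV.
Qed.

Lemma G_group_closed F F' : group_closed (fun g => g \in G_set F F').
Proof.
split.
  rewrite inE; split; first by move=> v; rewrite local_action1 group1.
  rewrite (_ : [set _ | _] = set0); first exact: finite_set0.
  by rewrite -subset0 => v /=; rewrite local_action1 group1.
move=> g h /set_mem[Ug fg] /set_mem[Uh fh]; rewrite inE; split.
  by move=> v; rewrite local_actionM local_actionV groupM // groupV.
apply: (@sub_finite_set _ _ (h @` ([set v | local_action h v \notin F] `|`
  [set v | local_action g v \notin F]))); last first.
  by apply: finite_image; rewrite finite_setU.
move=> v /=; rewrite local_actionM local_actionV => nF.
exists (h^-1 v); last exact: autVK.
case: (boolP (local_action h (h^-1 v) \in F)) => hF; last by left.
by right; apply: contra nF => gF; rewrite groupM // groupV.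
Qed.

End LocalAction.
End Tree.

(* [U(F)] with the permutation topology, i.e. the topology induced by [Aut(T)] *)
Definition U_group d (T : regTree d) (c : colouring T) (F : {group 'S_d}) : Type :=
  set_type (U_set c F).

Section UF.
Context d (T : regTree d) (c : colouring T) (F : {group 'S_d}).
HB.instance Definition _ := SubChoice.on (U_group c F).
HB.instance Definition _ := SubChoice_isSubGroup.Build (aut T)
  (fun g => g \in U_set c F) (U_group c F) (@U_group_closed d T c F).
HB.instance Definition _ := Topological.on (U_group c F).
End UF.

(* [G(F, F')]; a plain sigma type, so that it does not inherit the topology of
   [Aut(T)], which is in general coarser than the one defined below *)
Definition G_group d (T : regTree d) (c : colouring T) (F F' : {group 'S_d})
  (sFF' : F \subset F') : Type := {g : aut T | g \in G_set c F F'}.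

Section GFF.
Context d (T : regTree d) (c : colouring T) (F F' : {group 'S_d}).
Context (sFF' : F \subset F').
Local Notation G := (G_group c sFF').
Local Notation U := (U_group c F).
HB.instance Definition _ := SubChoice.on G.
HB.instance Definition _ := SubChoice_isSubGroup.Build (aut T)
  (fun g => g \in G_set c F F') G (@G_group_closed d T c F F').

Fact U_sub_G (u : U) : val u \in G_set c F F'.
Proof.
have Uu := set_mem (valP u); rewrite inE; split.
  by move=> v; exact: (fintype.subsetP sFF' _ (Uu v)).
rewrite (_ : [set _ | _] = set0); first exact: finite_set0.
by rewrite -subset0 => v /=; rewrite Uu.
Qed.

Definition incl (u : U) : G := Sub (val u) (U_sub_G u).

(* [W] is open when [{u in U(F) | g u in W}] is open in [U(F)] for all [g]; that
   this is the unique group topology on [G(F, F')] making the inclusion of [U(F)]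
   continuous and open is proved in [G_mul_continuous], [G_inv_continuous],
   [incl_continuous], [incl_open] and [G_topology_unique]. *)
Definition G_open (W : set G) := forall g : G, open [set u : U | W (g * incl u)].

Lemma G_openT : G_open setT.
Proof. by move=> g; exact: openT. Qed.

Lemma G_openI : setI_closed G_open.
Proof. by move=> A B oA oB g; exact: openI (oA g) (oB g). Qed.

Lemma G_open_bigU (I : Type) (f : I -> set G) :
  (forall i, G_open (f i)) -> G_open (\bigcup_i f i).
Proof.
move=> o g; by apply: (@bigcup_open U I setT (fun i => [set u : U | f i (g * incl u)])) => i _; exact: o.
Qed.

HB.instance Definition _ :=
  isOpenTopological.Build G G_openT G_openI G_open_bigU.

Lemma U_valM (u w : U) : val (u * w) = val u * val w. Proof. by []. Qed.
Lemma U_valV (u : U) : val u^-1 = (val u)^-1. Proof. by []. Qed.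
Lemma G_valM (g h : G) : val (g * h) = val g * val h. Proof. by []. Qed.
Lemma G_valV (g : G) : val g^-1 = (val g)^-1. Proof. by []. Qed.
Lemma val_incl (u : U) : val (incl u) = val u. Proof. by []. Qed.

Let VM := (U_valM, G_valM).
Let VV := (U_valV, G_valV).

Lemma U_openP (W : set U) : open W <-> forall u, W u ->
  exists2 B : set T, finite_set B &
    forall w : U, (forall v, B v -> val w v = val u v) -> W w.
Proof.
split=> [[O oO <-] u /oO [B fB HB]|oW].
  by exists B => // w e; apply: HB => v /e.
exists [set g : aut T | exists2 B : set T, finite_set B &
    forall w : U, (forall v, B v -> val w v = g v) -> W w].
  move=> g [B fB HB]; exists B => // h hg; exists B => // w wh.
  by apply: HB => v Bv; rewrite wh // hg.
rewrite predeqE => u; split=> [[B fB HB]|/oW]; last by [].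
by apply: HB.
Qed.

Lemma G_openE (W : set G) : open W = G_open W. Proof. by []. Qed.

Lemma G_nbhsP (g : G) (W : set G) : nbhs g W <->
  exists2 B : set T, finite_set B &
    forall u : U, (forall v, B v -> val u v = v) -> W (g * incl u).
Proof.
split.
  rewrite nbhsE => -[O [/(_ g) /U_openP oO Og] OW].
  have [|B fB HB] := oO 1.
    by rewrite /= (_ : incl 1 = 1) ?mulg1 //; apply: val_inj.
  by exists B => // u uB; apply/OW/HB.
move=> [B fB HB]; rewrite nbhsE.
exists [set g * incl u | u in [set u : U | forall v, B v -> val u v = v]];
    last by move=> _ [u uB <-]; exact: HB.
split; last first.
  by exists 1 => //; rewrite (_ : incl 1 = 1) ?mulg1 //; apply: val_inj.
move=> h; apply/U_openP => w [u /= uB guhw].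
exists B => // w' w'w; exists (u * (w^-1 * w')).
  move=> v Bv; rewrite !VM VV !autM w'w // autKV.
  exact: uB.
apply: val_inj; rewrite !VM !val_incl !VM VV.
have : val (g * incl u) = val (h * incl w) by rewrite guhw.
by rewrite !VM !val_incl => e; rewrite !mulgA e mulgK.
Qed.

Lemma finite_adj (v : T) : finite_set [set w | adj v w].
Proof. by exists d; exact: tree_regular. Qed.

Lemma conj_incl (h : G) (B : set T) : finite_set B ->
  exists2 B' : set T, finite_set B' &
    forall u : U, (forall v, B' v -> val u v = v) ->
      exists2 w : U, incl u * h = h * incl w & forall v, B v -> val w v = v.
Proof.
move=> fB; have [_ fS] := set_mem (valP h).
set S := [set v | _] in fS; set hS := val h @` S.
exists (val h @` B `|` hS `|` \bigcup_(v in hS) [set w | adj v w]).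
  rewrite !finite_setU; split; first by split; exact: finite_image.
  by apply: bigcup_finite => [|v _]; [exact: finite_image | exact: finite_adj].
move=> u uB'.
have Uw : ((val h)^-1 * (val u * val h)) \in U_set c F.
  rewrite inE => v; rewrite !local_actionM local_actionV !autM.
  have uF x : local_action c (val u) x \in F := set_mem (valP u) x.
  have [vS|vS] := pselect (S v).
    have hSv : hS (val h v) by exists v.
    have uhv : val u (val h v) = val h v by apply: uB'; left; right.
    rewrite uhv autKV (@local_action_fix _ _ c _ (val h v)) //.
      by rewrite mulg1 mulgV group1.
    by move=> w vw; apply: uB'; right; exists (val h v).
  have hF x : ~ S x -> local_action c (val h) x \in F.
    by move=> /negP; rewrite negbK.
  apply: groupM; first by apply: groupM; [exact: hF | exact: uF].
  rewrite groupV; apply: hF => Sx; apply: vS.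
  have uhv := uB' (val u (val h v)).
  have e : val u (val h v) = val h v.
    apply: (bij_inj (aut_bij (val u))); apply: uhv; left; right.
    by exists ((val h)^-1 (val u (val h v))) => //; exact: autVK.
  by move: Sx; rewrite e autKV.
exists (exist (fun g => g \in U_set c F) _ Uw : U).
  by apply: val_inj; rewrite !VM /= !mulgA mulgV mul1g.
move=> v Bv; rewrite [LHS](_ : _ = (val h)^-1 (val u (val h v))) //.
rewrite (uB' (val h v)) ?autKV //.
by left; left; exists v.
Qed.

Lemma G_mul_continuous : continuous (fun x : G * G => x.1 * x.2).
Proof.
move=> [g h] W /G_nbhsP[B fB HB].
have [B' fB' HB'] := conj_incl h fB.
exists ([set g * incl u | u in [set u : U | forall v, B' v -> val u v = v]],
        [set h * incl u | u in [set u : U | forall v, B v -> val u v = v]]).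
  split; apply/G_nbhsP.
    by exists B' => // u uB; exists u.
  by exists B => // u uB; exists u.
move=> [a b] [/= [u uB' <-] [w wB <-]].
have [u' e u'B] := HB' u uB'.
have -> : g * incl u * (h * incl w) = g * h * incl (u' * w).
  rewrite (_ : incl (u' * w) = incl u' * incl w); last exact: val_inj.
  by rewrite !mulgA -(mulgA g) e !mulgA.
by apply: HB => v Bv; rewrite VM autM wB ?u'B.
Qed.

Lemma G_inv_continuous : continuous (fun x : G => x^-1).
Proof.
move=> g W /G_nbhsP[B fB HB].
have [B' fB' HB'] := conj_incl g^-1 fB.
apply/G_nbhsP; exists B' => // u uB' /=.
have [|w e wB] := HB' u^-1.
  by move=> v Bv; rewrite -{1}(uB' v Bv) VV autKV.
rewrite invgM (_ : (incl u)^-1 = incl u^-1); last exact: val_inj.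
by rewrite e; exact: HB.
Qed.

HB.instance Definition _ :=
  isTopologicalGroup.Build G G_mul_continuous G_inv_continuous.

Lemma incl_continuous : continuous incl.
Proof.
apply/continuousP => W /(_ 1); congr open.
by rewrite predeqE => u /=; rewrite mul1g.
Qed.

Lemma incl_open (W : set U) : open W -> open (incl @` W).
Proof.
move=> /U_openP oW; rewrite G_openE => g; apply/U_openP => u [w /oW[B fB HB] e].
have vu : val w = val g * val u.
  by have := congr1 val e; rewrite VM.
exists B => // u' u'u; exists (w * (u^-1 * u')).
  by apply: HB => v Bv; rewrite !VM VV !autM u'u // autKV.
by apply: val_inj; rewrite !VM !val_incl !VM VV vu !mulgA mulgK.
Qed.

Lemma G_topology_unique (H : topGroupType) (f : G -> H) :
  bijective f -> (forall x y, f (x * y) = f x * f y) ->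
  continuous (f \o incl) ->
  (forall W : set U, open W -> open ((f \o incl) @` W)) ->
  forall W : set G, open W <-> open (f @` W).
Proof.
move=> [f' fK f'K] fM fc fo W.
have Lc (h : H) : continuous (fun x : H => h * x).
  move=> x; apply: (@continuous_comp _ _ _ (fun x : H => (h, x))
    (fun z : H * H => z.1 * z.2)); last exact: mulg_continuous.
  by apply: cvg_pair; [exact: cvg_cst | exact: cvg_id].
have Lo (h : H) O : open O -> open [set h * x | x in O].
  move=> oO; rewrite (_ : image _ _ = (fun x => h^-1 * x) @^-1` O).
    by apply: open_comp oO => x _; exact: Lc.
  rewrite predeqE => x; split=> [[y Oy <-]|Ox]; first by rewrite /= mulKg.
  by exists (h^-1 * x) => //; rewrite mulVKg.
split=> oW.
  rewrite (_ : f @` W = \bigcup_(g : G)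
      [set f g * x | x in (f \o incl) @` [set u | W (g * incl u)]]).
    by apply: bigcup_open => g _; apply/Lo/fo/oW.
  rewrite predeqE => x; split=> [[g Wg <-]|[g _ [_ [u Wu <-] <-]]].
    exists g => //; exists (f (incl 1)).
      exists 1 => //=; rewrite (_ : incl 1 = 1) ?mulg1 //; exact: val_inj.
    by rewrite -fM (_ : incl 1 = 1) ?mulg1 //; exact: val_inj.
  by exists (g * incl u); rewrite ?fM.
move=> g; rewrite (_ : mkset _ = (f \o incl) @^-1` ((fun x => f g * x) @^-1` (f @` W))).
  apply: open_comp; first by move=> ? _; exact: fc.
  by apply: open_comp oW => ? _; exact: Lc.
rewrite predeqE => u /=; rewrite -fM; split=> [Wu|[k Wk]]; first by exists (g * incl u).
by move=> /(can_inj fK) <-.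
Qed.

End GFF.

Definition distinct_point_stabilisers d (F : {group 'S_d}) : Prop :=
  forall a b : 'I_d, 'C_F[a | 'P] = 'C_F[b | 'P] <-> a = b.

(* Main.v *)
From HB Require Import structures.
Require Import Defs.
From mathcomp Require Import all_boot finmap fingroup perm action.
From mathcomp Require Import all_classical topology.

(** Fix a base vertex. Following colours identifies the vertices of the tree
    with the reduced words in the colours (no letter twice in a row), because a
    reduced closed walk would contain a cycle; see [reduced_walk_inj]. An
    automorphism acts on words letter by letter through its local actions, and
    conversely prescribed local actions integrate to an automorphism
    ([transport_aut]).

    Elliptic elements are always uniscalar, for every pair F <= F'. Let g
    preserve a finite set A. For n large, the ball B of radius n around A is
    g-invariant and contains every vertex where the local action of g leaves F,
    together with its neighbours. The pointwise fixator of B in U(F) is compact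
    and open, and g normalises it: away from B conjugation by g multiplies local
    actions by elements of F, while at the singular vertices of g the elements of
    the fixator act trivially. This is [elliptic_uniscalar].

    If F has distinct point stabilisers, an element g of scale 1 is elliptic.
    Scale 1 means g U g^-1 <= U for some compact open U. The U-orbit of a vertex
    x is finite, and U (g^-n x) is contained in g^-n (U x), so all the vertices
    g^-n x have U-orbits of bounded size. But U contains the fixator K of a ball
    in U(F), and only finitely many vertices have K-orbits of size at most N
    ([finite_small_orbits]): walk outwards from the ball and let a, then b <> a,
    be two consecutive colours. Elements of F_a can be realised in K as local
    actions at the vertex between the two edges. Hence either some element of
    F_a moves b and the orbit grows strictly, or F_a <= F_b, and then
    |F_a| < |F_b| by distinctness. Either way orbit size and order of the
    stabiliser increase together lexicographically ([potential_step]), so the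
    orbit size tends to infinity with the distance. Consequently the orbit of x
    under g^-1 is finite, and g is elliptic ([scale1_elliptic]).

    If F_a = F_b for some a <> b, the translation by two edges along the line
    coloured a, b, a, b, ... with trivial local actions is uniscalar but not
    elliptic: an element of U(F) that fixes one edge of this line fixes the whole
    line, so the fixator of an edge is normalised by the translation
    ([uniscalar_translation]). *)

Set Implicit Arguments.
Unset Strict Implicit.
Unset Printing Implicit Defensive.

Local Open Scope classical_set_scope.
Local Open Scope group_scope.

Lemma card_fset_set_image (X Y : choiceType) (f : X -> Y) (A : set X) (B : set Y) :
  finite_set A -> B `<=` f @` A -> (#|` fset_set B| <= #|` fset_set A|)%fset%N.
Proof.
move=> fA BfA; have fB := sub_finite_set BfA (finite_image f fA).
have BfA' : (fset_set B `<=` f @` fset_set A)%fset.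
  by rewrite -fset_set_image // -fset_set_sub //; exact: finite_image.
by apply: leq_trans (fsubset_leq_card BfA') _; exact: leq_imfset_card.
Qed.

(** * Vertices as reduced words of colours *)

Section Words.
Variables (d : nat) (T : regTree d) (c : colouring T).
Implicit Types (x y v w : T) (a b : 'I_d) (s t : seq 'I_d) (g h : aut T).

Definition nbr v a : T := terminus (col_inv c v a).

Definition walk v s : T := foldl nbr v s.

Definition reduced s := sorted (fun a b => a != b) s.

Lemma adj_nbr v a : adj v (nbr v a).
Proof.
by have := svalP (col_inv c v a); rewrite -/(origin _) origin_col_inv.
Qed.

Lemma edge_eq (e e' : edge T) :
  origin e = origin e' -> terminus e = terminus e' -> e = e'.
Proof.
case: e e' => [[u v] e] [[u' v'] e']; rewrite /origin /terminus /= => ? ?; subst.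
by congr exist; exact: Prop_irrelevance.
Qed.

Lemma col_inv_uniq (e : edge T) : col_inv c (origin e) (c e) = e.
Proof. by apply: (@col_inj _ _ c); rewrite ?origin_col_inv ?col_invK. Qed.

Lemma adjP v w : adj v w -> exists a, w = nbr v a.
Proof.
move=> vw; exists (c (exist _ (v, w) vw)).
by rewrite /nbr -{1}[v]/(origin (exist _ (v, w) vw : edge T)) col_inv_uniq.
Qed.

Lemma nbr_inj v : injective (nbr v).
Proof.
move=> a b ab; rewrite -(col_invK c v a) -(col_invK c v b); congr (c _).
by apply: edge_eq; rewrite ?origin_col_inv.
Qed.

Lemma nbrK a : involutive (nbr^~ a).
Proof.
move=> v; rewrite /nbr; set e := col_inv c v a.
have -> : col_inv c (terminus e) a = rev_edge e.
  by rewrite -[terminus e]/(origin (rev_edge e)) -(col_invK c v a) -/e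
    -(col_rev c e) col_inv_uniq.
exact: (origin_col_inv c v a).
Qed.

Lemma aut_nbr g v a : g (nbr v a) = nbr (g v) (local_action c g v a).
Proof.
have /= := local_actionE c g (col_inv c v a).
rewrite origin_col_inv col_invK => ->.
rewrite -{2}(origin_col_inv c v a).
rewrite -[g (origin _)]/(origin (aut_edge g (col_inv c v a))).
by rewrite /nbr col_inv_uniq.
Qed.

Lemma local_actionI g v (f : 'S_d) :
  (forall a, g (nbr v a) = nbr (g v) (f a)) -> local_action c g v = f.
Proof.
by move=> H; apply/permP => a; apply: (@nbr_inj (g v)); rewrite -aut_nbr H.
Qed.

Lemma walk_cat v s t : walk v (s ++ t) = walk (walk v s) t.
Proof. exact: foldl_cat. Qed.

Lemma walk_rcons v s a : walk v (rcons s a) = nbr (walk v s) a.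
Proof. by rewrite -cats1 walk_cat. Qed.

Lemma walk_rev v s : walk (walk v s) (rev s) = v.
Proof.
elim: s v => //= a s IH v; rewrite rev_cons walk_rcons IH; exact: nbrK.
Qed.

Lemma walk_surj v w : exists s, w = walk v s.
Proof.
have [p + <-] := tree_connected v w.
elim: p v => [|u p IH] v /=; first by exists [::].
by move=> /andP[/adjP[a ->]] /IH[s ->]; exists (a :: s).
Qed.

Lemma reduced_rev s : reduced (rev s) = reduced s.
Proof. by rewrite /reduced rev_sorted; apply: eq_sorted => a b; rewrite eq_sym. Qed.

Lemma reduced_cat s a b t : reduced (rcons s a ++ b :: t) =
  [&& reduced (rcons s a), a != b & reduced (b :: t)].
Proof.
by rewrite /reduced; case: s => [|a' s] //=; rewrite cat_path last_rcons.
Qed.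

Lemma reduced_rcons s a : reduced (rcons s a) -> reduced s.
Proof. by rewrite /reduced -cats1 => /cat_sorted2[]. Qed.

Lemma reduce_walk v s : exists t,
  [/\ reduced t, (size t <= size s)%N & walk v t = walk v s].
Proof.
elim/last_ind: s => [|s a [t [rt ts e]]]; first by exists [::].
rewrite walk_rcons size_rcons -e.
case/lastP: t rt ts {e} => [|t b] rt ts; first by exists [:: a].
have [<-|ba] := eqVneq b a.
  exists t; split; first exact: reduced_rcons rt.
    by rewrite size_rcons in ts; do 2 apply: ltnW.
  by rewrite walk_rcons nbrK.
exists (rcons (rcons t b) a); split; last by rewrite !walk_rcons.
  by rewrite -cats1 reduced_cat rt ba.
by rewrite size_rcons.
Qed.

Lemma reduced_walk_surj v w : exists2 s, reduced s & w = walk v s.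
Proof.
by have [s ->] := walk_surj v w; have [t [rt _ <-]] := reduce_walk v s; exists t.
Qed.

(** A shortest counterexample visits pairwise distinct vertices, since a
    repetition would cut out a shorter one; it is then a cycle, so it has length
    at most 2 by acyclicity, and a reduced word of length 1 or 2 is never closed. *)
Lemma reduced_closed v s : reduced s -> walk v s = v -> s = [::].
Proof.
have [n] := ubnP (size s); elim: n v s => // n IH v s sn rs ws.
pose p := scanl nbr v s.
have pathp : path (@adj d T) v p.
  by rewrite /p; elim: (s) (v) => //= a t IHt u; rewrite adj_nbr IHt.
have nthp i : (i < size s)%N -> nth v p i = walk v (take i.+1 s).
  by move=> lis; rewrite /p nth_scanl.
have lastp : last v p = v.
  by rewrite -{2}ws /p; elim: (s) (v) => //= a t IHt u; rewrite IHt.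
have [up|/(uniqPn v)[i [j [lij]]]] := boolP (uniq p); last first.
  rewrite size_scanl => ljs; rewrite !nthp ?(ltn_trans lij)// => e.
  pose t := drop i.+1 (take j.+1 s).
  have tE : take j.+1 s = take i.+1 s ++ t.
    by rewrite -{1}(cat_take_drop i.+1 (take j.+1 s)) take_takel // ltnW.
  suff : t = [::].
    move/(congr1 size); rewrite size_drop size_takel // subSS => /eqP.
    by rewrite subn_eq0 leqNgt lij.
  apply: (IH (walk v (take i.+1 s))).
  - rewrite size_drop size_takel // subSS; rewrite ltnS in sn; apply: leq_trans sn.
    exact: leq_ltn_trans (leq_subr _ _) ljs.
  - by apply/drop_sorted/take_sorted.
  - by rewrite -walk_cat -tE.
have up2 : ucycle (@adj d T) p.
  by rewrite /ucycle up andbT (cycle_path v) lastp.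
have := tree_acyclic up2; rewrite size_scanl.
case: s rs ws {sn p pathp nthp lastp up up2} => [|a [|b []]] //=.
  by move=> _ ws; have := adj_nbr v a; rewrite ws adj_irr.
rewrite andbT => ab; rewrite -{2}(nbrK a v) => /nbr_inj e.
by rewrite e eqxx in ab.
Qed.

(** If the last letters differ, walking along [s] and back along [t] is a reduced
    closed walk. *)
Lemma reduced_walk_inj v s t :
  reduced s -> reduced t -> walk v s = walk v t -> s = t.
Proof.
elim/last_ind: s t => [|s a IH] t; first by move=> _ rt /esym /(reduced_closed rt).
case/lastP: t => [|t b]; first by move=> rs _ /(reduced_closed rs).
rewrite !walk_rcons => rs rt e; have [ab|ab] := eqVneq a b.
  rewrite -ab in e *; congr rcons; apply: IH; last exact: (inv_inj (@nbrK a)) e.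
    exact: reduced_rcons rs.
  exact: reduced_rcons rt.
have : rcons s a ++ b :: rev t = [::]; last by case: (s).
apply: (@reduced_closed v).
  by rewrite reduced_cat rs ab -rev_rcons reduced_rev.
by rewrite walk_cat walk_rcons e -walk_rcons -rev_rcons walk_rev.
Qed.

Definition word v w := sval (cid2 (reduced_walk_surj v w)).

Lemma word_reduced v w : reduced (word v w).
Proof. by rewrite /word; case: cid2. Qed.

Lemma walk_word v w : walk v (word v w) = w.
Proof. by rewrite /word; case: cid2. Qed.

Lemma word_walk v s : reduced s -> word v (walk v s) = s.
Proof.
by move=> rs; apply: (@reduced_walk_inj v); rewrite ?word_reduced ?walk_word.
Qed.

(** * Automorphisms with prescribed local actions *)

Section Transport.
Variables (phi : T -> T) (sigma : T -> 'S_d).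
Hypothesis phi_nbr : forall v a, phi (nbr v a) = nbr (phi v) (sigma v a).

Fixpoint transport v s :=
  if s is a :: s' then sigma v a :: transport (nbr v a) s' else [::].

Lemma transport_walk v s : walk (phi v) (transport v s) = phi (walk v s).
Proof. by elim: s v => //= a s IH v; rewrite -phi_nbr IH. Qed.

Lemma size_transport v s : size (transport v s) = size s.
Proof. by elim: s v => //= a s IH v; rewrite IH. Qed.

Lemma transport_cat v s t :
  transport v (s ++ t) = transport v s ++ transport (walk v s) t.
Proof. by elim: s v => //= a s IH v; rewrite IH. Qed.

(** Both endpoints of an edge see the same image of its colour; this is what
    keeps words reduced under [transport]. *)
Lemma sigma_nbr v a : sigma (nbr v a) a = sigma v a.
Proof.
by apply: (@nbr_inj (phi (nbr v a))); rewrite -phi_nbr nbrK phi_nbr nbrK.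
Qed.

Lemma reduced_transport v s : reduced s -> reduced (transport v s).
Proof.
case: s => //= a s; rewrite /reduced /=.
elim: s v a => //= b s IH v a /andP[ab rs].
by rewrite -sigma_nbr (inj_eq perm_inj) ab IH.
Qed.

Lemma transport_surj v t : exists s, transport v s = t.
Proof.
elim: t v => [|b t IH] v; first by exists [::].
have [s e] := IH (nbr v ((sigma v)^-1 b)%g).
by exists ((sigma v)^-1%g b :: s); rewrite /= permKV e.
Qed.

(** [phi] is a covering map of the tree, and it is injective because it maps the
    reduced word between two vertices to a reduced word of the same length. *)
Lemma transport_bij : bijective phi.
Proof.
have inj : injective phi.
  move=> v w; rewrite -(walk_word v w) -transport_walk => /esym e.
  have := reduced_closed (reduced_transport v (word_reduced v w)) e.
  by move/(congr1 size); rewrite size_transport; case: word.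
have sur w : exists v, phi v = w.
  have [v0] := tree_nonempty T.
  have [s sE] := transport_surj v0 (word (phi v0) w).
  by exists (walk v0 s); rewrite -transport_walk sE walk_word.
pose psi w := sval (cid (sur w)).
have psiK : cancel psi phi by move=> w; rewrite /psi; case: cid.
by exists psi => // v; apply: inj; rewrite psiK.
Qed.

Lemma transport_adj u v : adj (phi u) (phi v) = adj u v.
Proof.
apply/idP/idP => [/adjP[b e]|/adjP[a ->]]; last by rewrite phi_nbr adj_nbr.
rewrite (_ : v = nbr u ((sigma u)^-1 b)%g) ?adj_nbr //.
by apply: (bij_inj transport_bij); rewrite phi_nbr permKV.
Qed.

Definition transport_aut : aut T := Aut transport_bij transport_adj.

End Transport.

Lemma aut_walk g v s :
  g (walk v s) = walk (g v) (transport (local_action c g) v s).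
Proof. by rewrite (transport_walk (aut_nbr g)). Qed.

(** The only compatibility condition between local actions at adjacent vertices is
    agreement on the colour of the edge, so the branches at [x] can be given
    constant local actions [rho b] independently of each other. Two cases are
    used: [rho] constant, which gives translations with trivial local actions,
    and [rho] trivial on a single branch, which gives elements supported
    away from a half-tree. *)
Lemma branch_aut x y (f : 'S_d) (rho : 'I_d -> 'S_d) :
    (forall b, rho b b = f b) ->
  exists g, [/\ g x = y, local_action c g x = f &
    forall b s, reduced (b :: s) ->
      local_action c g (walk x (b :: s)) = rho b /\
      g (walk x (b :: s)) = walk y (map (rho b) (b :: s))].
Proof.
move=> rhof.
(* the map and its local actions, in terms of words read from x *)
pose phiw s := if s is b :: _ then walk y (map (rho b) s) else y.
pose sigw s := if s is b :: _ then rho b else f.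
have H v a : phiw (word x (nbr v a)) = nbr (phiw (word x v)) (sigw (word x v) a).
  rewrite -{1}(walk_word x v); have := word_reduced x v.
  case/lastP: (word x v) => [|s b] rs.
    by rewrite /= (@word_walk x [:: a]) //= rhof.
  have [<-|ba] := eqVneq b a.
    rewrite walk_rcons nbrK word_walk; last exact: reduced_rcons rs.
    case: s {rs} => [|b' s] /=; first by rewrite nbrK.
    by rewrite map_rcons walk_rcons nbrK.
  rewrite -walk_rcons word_walk; last by rewrite -cats1 reduced_cat rs ba.
  by case: s {rs} => [|b' s] //=; rewrite !map_rcons !walk_rcons.
have wx : word x x = [::] by exact: (@word_walk x [::]).
exists (transport_aut H); split; first by rewrite /= wx.
  by apply: local_actionI => a; rewrite /= H wx.
move=> b s /(word_walk x); move: (walk x (b :: s)) => w wbs.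
by split; [apply: local_actionI => a; rewrite /= H wbs | rewrite /= wbs].
Qed.

Definition tree_ball n v : set T := [set walk v s | s in [set s | (size s <= n)%N]].

Lemma tree_ball_center n v : tree_ball n v v.
Proof. by exists [::]. Qed.

Lemma sub_tree_ball m n v : (m <= n)%N -> tree_ball m v `<=` tree_ball n v.
Proof. by move=> mn w [s /= sm <-]; exists s => //=; exact: leq_trans mn. Qed.

Lemma finite_tree_ball n v : finite_set (tree_ball n v).
Proof.
apply: finite_image.
rewrite (_ : mkset _ =
    \bigcup_(i in `I_n.+1) [set tval t | t in @setT (i.-tuple 'I_d)]).
  by apply: bigcup_finite => // i _; apply: finite_image; exact: finite_finset.
apply/seteqP; split=> [s sn|_ [i /= lin [t _ <-]]] /=.
  by exists (size s) => //; exists (in_tuple s).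
by rewrite size_tuple.
Qed.

Lemma finite_sub_tree_ball (B : set T) v :
  finite_set B -> exists n, B `<=` tree_ball n v.
Proof.
move=> fB; exists (\max_(w <- fset_set B) size (word v w))%N => w Bw.
exists (word v w); last exact: walk_word.
by apply: (@leq_bigmax_seq _ _ xpredT) => //; rewrite in_fset_set // inE.
Qed.

Lemma aut_tree_ball g n v w : tree_ball n v w -> tree_ball n (g v) (g w).
Proof.
by move=> [s sn <-]; rewrite aut_walk; exists (transport (local_action c g) v s) => //=;
  rewrite size_transport.
Qed.

End Words.

(** * Growth of orbits of ball fixators *)

Section Orbits.
Variables (d : nat) (T : regTree d) (c : colouring T) (F : {group 'S_d}).
Variables (x0 : T) (r : nat).

Definition fix_ball : set (aut T) :=
  [set u | U_set c F u /\ forall v, tree_ball c r x0 v -> u v = v].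

Definition orb v : set T := [set (u : aut T) v | u in fix_ball].

Lemma finite_orb v : finite_set (orb v).
Proof.
have [n nP] := finite_sub_tree_ball c x0 (finite_set1 v).
apply: (sub_finite_set _ (finite_tree_ball c n x0)) => _ [u [_ ux] <-].
rewrite -(ux x0); last exact: tree_ball_center.
by apply: aut_tree_ball; apply: nP.
Qed.

Definition orb_size v := #|` fset_set (orb v)|%fset.

(** The neighbour of [v] on the way to [x0]. Since [fix_ball] fixes [x0], this map
    commutes with it and maps the orbit of a vertex onto that of its parent. *)
Definition parent v := walk c x0 (take (size (word c x0 v)).-1 (word c x0 v)).

Lemma parent_aut (u : aut T) s a : u x0 = x0 -> reduced (rcons s a) ->
  parent (u (walk c x0 (rcons s a))) = u (walk c x0 s).
Proof.
move=> ux rs; rewrite /parent aut_walk ux word_walk; last first.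
  exact: (reduced_transport (aut_nbr c u)).
rewrite size_transport size_rcons -cats1 transport_cat take_size_cat ?size_transport //.
by rewrite -{1}ux -aut_walk.
Qed.

(** The orbit of a vertex surjects onto the orbit of its parent, and it still does
    after removing one point when an element fixing the parent moves the vertex. *)
Lemma orb_size_step s a : reduced (rcons s a) ->
  (orb_size (walk c x0 s) <= orb_size (walk c x0 (rcons s a)))%N /\
  forall u, fix_ball u -> u (walk c x0 s) = walk c x0 s ->
    u (walk c x0 (rcons s a)) <> walk c x0 (rcons s a) ->
    (orb_size (walk c x0 s) < orb_size (walk c x0 (rcons s a)))%N.
Proof.
move=> rs; set v := walk c x0 s; set w := walk c x0 (rcons s a).
have fx u : fix_ball u -> u x0 = x0 by move=> [_]; apply; exact: tree_ball_center.
have par u : fix_ball u -> parent (u w) = u v.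
  by move=> /fx ux; rewrite parent_aut.
have le (A : set T) : A `<=` orb w -> orb v `<=` parent @` A ->
    (orb_size v <= #|` fset_set A|)%N.
  by move=> Aw; apply: card_fset_set_image; exact: sub_finite_set (finite_orb w).
split; first by apply: le => // _ [u Ku <-]; exists (u w); [exists u | exact: par].
move=> u Ku uv uw; apply: (@leq_ltn_trans #|` fset_set (orb w `\ u w)|%fset).
  apply: le => [y []//|_ [h Kh <-]].
  have [hu|hu] := pselect (h w = u w); last first.
    by exists (h w); [split; [exists h|]|exact: par].
  have K1 : fix_ball 1 by split=> // y; rewrite local_action1 group1.
  exists w; first by split; [exists 1 | move=> wu; exact: uw].
  by have := par _ K1; rewrite !aut1 => ->; rewrite -(par h) // hu par.
rewrite /orb_size fset_setD1; last exact: finite_orb.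
rewrite [ltnRHS](cardfsD1 (u w)) in_fset_set; last exact: finite_orb.
by rewrite mem_set //; exists u.
Qed.

(** Beyond the ball, every element of F fixing the colour of the incoming edge is
    the local action of some element of [fix_ball]: let it act trivially on the
    branch containing [x0], and by [f] everywhere else. *)
Lemma branch_fix s a (f : 'S_d) : reduced (rcons s a) -> (r <= size s)%N ->
    f \in F -> f a = a ->
  exists u, [/\ fix_ball u, u (walk c x0 (rcons s a)) = walk c x0 (rcons s a)
    & local_action c u (walk c x0 (rcons s a)) = f].
Proof.
move=> rs sr fF fa; set x := walk c x0 (rcons s a).
pose rho b : 'S_d := if b == a then 1 else f.
have [|u [ux uf ub]] := @branch_aut _ _ c x x f rho.
  by move=> b; rewrite /rho; case: eqP => // ->; rewrite fa perm1.
exists u; split=> //; split=> [v|_ [t /= tr <-]].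
  rewrite -(walk_word c x v); have := word_reduced c x v.
  case: word => [|b q] rq; first by rewrite uf.
  by have [-> _] := ub _ _ rq; rewrite /rho; case: ifP => // _; rewrite group1.
have [t' [rt' t't <-]] := reduce_walk c x0 t; set v := walk c x0 t'.
rewrite -(walk_word c x v); case wE: (word c x v) => [|b q].
  exact: ux.
have rq : reduced (b :: q) by rewrite -wE word_reduced.
(* otherwise the path from x0 to v would pass through x, outside the ball *)
have [ba|ba] := eqVneq a b; last first.
  suff e : t' = rcons s a ++ b :: q.
    move: t't; rewrite e size_cat size_rcons leqNgt.
    by rewrite (leq_trans _ (leq_addr _ _)) // ltnS (leq_trans tr).
  apply: (@reduced_walk_inj _ _ c x0) => //; first by rewrite reduced_cat rs ba.
  by rewrite walk_cat -wE walk_word.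
have [_ ->] := ub _ _ rq; congr walk.
by apply: map_id_in => y _; rewrite /rho ba eqxx perm1.
Qed.

Lemma mem_stab (a : 'I_d) (f : 'S_d) : (f \in 'C_F[a | 'P]) = (f \in F) && (f a == a).
Proof. by rewrite finset.inE; congr andb; apply/astab1P/eqP. Qed.

Lemma card_stab_le (a : 'I_d) : (#|'C_F[a | 'P]| <= #|F|)%N.
Proof. by rewrite subset_leq_card // subsetIl. Qed.

(** Orbit size first, order of the stabiliser of the last colour second, compared
    lexicographically: the stabiliser has order between 1 and [#|F|]. *)
Definition potential s a :=
  (orb_size (walk c x0 (rcons s a)) * #|F| + #|'C_F[a | 'P]|)%N.

(** Either some element of F_a moves [b], and by [branch_fix] the orbit grows; or
    F_a is contained in F_b, properly since [a] and [b] are distinct. *)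
Lemma potential_step s a b : distinct_point_stabilisers F ->
  reduced (rcons (rcons s a) b) -> (r <= size s)%N ->
  (potential s a < potential (rcons s a) b)%N.
Proof.
rewrite /potential => dF rsab sr.
have rs := reduced_rcons rsab.
have ab : a != b by move: {+}rsab; rewrite -cats1 reduced_cat => /and3P[].
have [le lt] := orb_size_step rsab.
have [sCab|/fintype.subsetPn[f]] := boolP ('C_F[a | 'P] \subset 'C_F[b | 'P]).
  rewrite -addnS leq_add ?leq_mul2r ?le ?orbT //.
  apply: proper_card; rewrite finset.properEneq sCab andbT.
  by apply: contra ab => /eqP /dF ->.
rewrite !mem_stab => /andP[fF /eqP fa]; rewrite fF /= => fb.
have [u [Ku ux uf]] := branch_fix rs sr fF fa.
have {}lt : (orb_size (walk c x0 (rcons s a)) <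
    orb_size (walk c x0 (rcons (rcons s a) b)))%N.
  apply: (lt u) => //; rewrite [walk _ _ (rcons _ b)]walk_rcons aut_nbr ux uf.
  by move=> /nbr_inj e; rewrite e eqxx in fb.
rewrite -addn1 leq_add ?cardG_gt0 //.
apply: leq_trans (_ : _ <= (orb_size (walk c x0 (rcons s a))).+1 * #|F|)%N _.
  by rewrite mulSn addnC leq_add2r card_stab_le.
by rewrite leq_mul2r lt orbT.
Qed.

Lemma potential_grows s a : distinct_point_stabilisers F ->
  reduced (rcons s a) ->
  (size s - r < potential s a)%N.
Proof.
move=> dF; elim/last_ind: s a => [|s b IH] a rs.
  by rewrite sub0n /potential addn_gt0 cardG_gt0 orbT.
have [rs'|sr] := leqP r (size s).
  apply: leq_ltn_trans (potential_step dF rs rs').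
  by rewrite size_rcons subSn // IH // (reduced_rcons rs).
rewrite size_rcons (eqP (_ : _ - _ == 0)%N) ?subn_eq0 //.
by rewrite /potential addn_gt0 cardG_gt0 orbT.
Qed.

(** The potential of a vertex with orbit size at most [N] is at most
    [N.+1 * #|F|], whereas it grows with the distance to [x0]. *)
Lemma finite_small_orbits N : distinct_point_stabilisers F ->
  finite_set [set v | (orb_size v <= N)%N].
Proof.
move=> dF.
apply: (sub_finite_set _ (finite_tree_ball c (N.+1 * #|F| + r).+1 x0)) => v /= vN.
rewrite -(walk_word c x0 v); exists (word c x0 v) => //=.
have := word_reduced c x0 v; have := walk_word c x0 v.
case/lastP: (word c x0 v) => // s a e /(potential_grows dF).
rewrite /potential e size_rcons ltnS => H.
rewrite addnC -leq_subLR; apply: ltnW; apply: leq_trans H _.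
by rewrite mulSn addnC leq_add ?card_stab_le // leq_mul2r vN orbT.
Qed.

End Orbits.

(** * Compact open subgroups of G(F, F') *)

Section Fixator.
Variables (d : nat) (T : regTree d) (c : colouring T).
Variables (F F' : {group 'S_d}) (sFF' : F \subset F').
Local Notation G := (G_group c sFF').
Implicit Types (B : set T) (g h : G).

(** The fixator is taken in U(F), not in G(F, F'): vertex stabilisers of the latter
    are in general not compact. *)
Definition fixator B : set G :=
  [set h | U_set c F (val h) /\ forall v, B v -> val h v = v].

(* the covering characterisation of compactness is stated for pointed spaces *)
HB.instance Definition _ := isPointed.Build G 1.

Lemma fixator_incl B h : fixator B h <->
  exists2 u : U_group c F, (forall v, B v -> val u v = v) & Defs.incl sFF' u = h.
Proof.
split=> [[Uh hB]|[u uB <-]]; last by split=> //; exact: set_mem (valP u).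
by exists (exist _ (val h) (mem_set Uh) : U_group c F) => //; apply: val_inj.
Qed.

Lemma fixator_subgroup B : is_subgroup (fixator B).
Proof.
split; first by split=> v; rewrite ?local_action1 ?group1.
- move=> x y [Ux xB] [Uy yB]; split=> [v|v Bv].
    by rewrite G_valM local_actionM groupM.
  by rewrite G_valM autM yB ?xB.
- move=> x [Ux xB]; split=> [v|v Bv].
    by rewrite G_valV local_actionV groupV.
  by rewrite G_valV -{1}(xB v Bv) autKV.
Qed.

Lemma fixator_open B : finite_set B -> open (fixator B).
Proof.
move=> fB; rewrite openE => h [Uh hB]; apply/G_nbhsP; exists B => // u uB.
have [_ mulK _] := fixator_subgroup B.
apply: mulK; first by split.
by apply/fixator_incl; exists u.
Qed.

(** Along an ultrafilter on the fixator, the image of each vertex under [h] and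
    under [h^-1] is eventually constant, as it stays in a ball around a fixed
    vertex. These eventual values define an automorphism of the tree and its
    inverse. Its local action at a vertex only depends on finitely many values,
    so it agrees there with that of an element of the fixator. *)
Lemma fixator_compact B : finite_set B -> B !=set0 -> compact (fixator B).
Proof.
move=> fB [x Bx]; rewrite compact_ultra => UF UUF UFB.
have PF : ProperFilter UF by exact: ultra_proper.
have ex W : UF W -> exists2 h, fixator B h & W h.
  by move=> UW; have [h []] := filter_ex (filterI UFB UW); exists h.
(* used with e h = h and with e h = h^-1 *)
have lim (e : G -> aut T) v : (forall h, fixator B h -> e h x = x) ->
    exists w, UF [set h | e h v = w].
  move=> ex_x; have [n nP] := finite_sub_tree_ball c x (finite_set1 v).
  apply: contrapT => /forallNP noW.
  have : UF (\bigcap_(w in [set` fset_set (tree_ball c n x)]) ~` [set h | e h v = w]).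
    apply: filter_bigI => w _.
    by have [/noW|] := in_ultra_setVsetC [set h | e h v = w] UUF.
  move=> /ex[h hB /= H]; apply: (H (e h v)) => //=.
  rewrite in_fset_set ?inE; last exact: finite_tree_ball.
  by rewrite -(ex_x h hB); apply: aut_tree_ball; exact: nP.
have [phi phiP] := @choice _ _ _ (fun v => lim val v (fun h hB => hB.2 x Bx)).
have valVx h : fixator B h -> (val h)^-1 x = x.
  by move=> hB; have [_ _ /(_ h hB)[_ /(_ x Bx)]] := fixator_subgroup B; rewrite G_valV.
have [psi psiP] := @choice _ _ _ (fun v => lim (fun h => (val h)^-1) v valVx).
have psiK : cancel psi phi.
  move=> v; have [h _ [/= <- e]] := ex _ (filterI (phiP (psi v)) (psiP v)).
  by rewrite -e autVK.
have phiK : cancel phi psi.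
  move=> v; have [h _ [/= <- e]] := ex _ (filterI (psiP (phi v)) (phiP v)).
  by rewrite -e; exact: autKV.
have phi_adj u v : adj (phi u) (phi v) = adj u v.
  by have [h _ [/= <- <-]] := ex _ (filterI (phiP u) (phiP v)); rewrite aut_adj.
pose g : aut T := Aut (Bijective phiK psiK) phi_adj.
have near_g B' : finite_set B' -> UF [set h : G | forall v, B' v -> val h v = g v].
  move=> fB'; apply: (@filterS _ _ _
      (\bigcap_(v in [set` fset_set B']) [set h : G | val h v = phi v])).
    by move=> h H v B'v; apply: H => /=; rewrite in_fset_set ?inE.
  by apply: filter_bigI => v _; exact: phiP.
have gU : U_set c F g.
  move=> v; have [h [Uh _] /= hg] := ex _ (near_g _ (finite_tree_ball c 1 v)).
  rewrite (_ : local_action c g v = local_action c (val h) v) //.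
  apply: (@local_actionI _ _ c) => a.
  rewrite -[g v](hg v); last exact: tree_ball_center.
  by rewrite -aut_nbr; symmetry; apply: hg; exists [:: a].
have gB v : B v -> g v = v.
  by move=> Bv; have [h [_ hB] hg] := ex _ (near_g _ fB); rewrite -hg // hB.
have gG : g \in G_set c F F'.
  exact: (U_sub_G sFF' (exist _ g (mem_set gU) : U_group c F)).
exists (exist _ g gG : G); split; first by split.
move=> W /G_nbhsP[B' fB' HB'].
apply: filterS (filterI UFB (near_g _ fB')) => h [[Uh hB] hg].
have Uu : U_set c F (g^-1 * val h).
  by move=> v; rewrite local_actionM local_actionV groupM ?groupV.
pose u : U_group c F := exist (fun k => k \in U_set c F) _ (mem_set Uu).
rewrite (_ : h = (exist _ g gG : G) * Defs.incl sFF' u).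
  by apply: HB' => v B'v; rewrite -[RHS](autKV g) -(hg v B'v).
by apply: val_inj; rewrite G_valM val_incl /= mulgA mulgV mul1g.
Qed.

Lemma stabilizer_open v w : open [set h : G | val h v = w].
Proof.
rewrite openE => h /= hv; apply/G_nbhsP; exists [set v]; first exact: finite_set1.
by move=> u uv; rewrite -hv -[X in val h X]uv.
Qed.

Lemma finite_compact_orbit (K : set G) v :
  compact K -> finite_set [set val h v | h in K].
Proof.
rewrite -[compact K]/(@compact G K) (@compact_cover G).
move=> /(_ _ setT (fun w => [set h : G | val h v = w])).
case=> [w _|h _|D _ KD]; first exact: stabilizer_open.
  by exists (val h v).
apply: (@sub_finite_set _ _ [set` D]); last exact: finite_fset.
by move=> _ [h /KD[w Dw /= hw] <-]; rewrite hw.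
Qed.

End Fixator.

(** * Scale one *)

Section ScaleOne.
Variable G : topGroupType.
Implicit Types (g : G) (U : set G).

(** Index one leaves a single coset, so each element of the conjugate lies in the
    coset of 1, that is, in [U]. *)
Lemma scale1_sub g : scale g = 1%N ->
  exists2 U, [/\ is_subgroup U, compact U & open U] & Defs.conjugate g U `<=` U.
Proof.
rewrite /scale; case: xgetP => // n -> [+ _] n1; rewrite n1.
move=> [U [gU cU oU /(@eq_cardSP _ _ 0%N)[C _]]]; rewrite II0 card_eq0 => /eqP E.
exists U; first by split.
have one A : left_cosets (Defs.conjugate g U) (Defs.conjugate g U `&` U) A -> A = C.
  move=> LA; apply: contrapT => AC.
  by have : (set0 : set (set G)) A by rewrite -E; split.
have [U1 UM UV] := gU.
have c1 : Defs.conjugate g U 1 by exists 1 => //; rewrite mulg1 mulgV.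
move=> h ch; set K := Defs.conjugate g U `&` U.
have e : [set h * k | k in K] = [set 1 * k | k in K].
  by apply: etrans (one _ _) (esym (one _ _)); [exists h|exists 1].
have : [set h * k | k in K] h by exists 1; [split | rewrite mulg1].
by rewrite e => -[k [_ Uk] <-]; rewrite mul1g.
Qed.

Lemma normalised_scale1 g U : is_subgroup U -> compact U -> open U ->
  Defs.conjugate g U = U -> scale g = 1%N.
Proof.
move=> gU cU oU gUg.
have i1 : scale_indices g 1%N.
  exists U; split=> //; rewrite gUg setIid.
  rewrite (_ : left_cosets U U = [set U]) ?card_set1 //.
  have [U1 UM UV] := gU.
  apply/seteqP; split=> [_ [h Uh <-]|_ ->] /=.
    apply/seteqP; split=> [_ [k Uk <-]|k Uk]; first exact: UM.
    by exists (h^-1 * k); rewrite ?mulVKg //; apply: UM => //; exact: UV.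
  exists 1 => //; apply/seteqP; split=> [_ [k Uk <-]|k Uk]; first by rewrite mul1g.
  by exists k; rewrite ?mul1g.
have min m : scale_indices g m -> (1 <= m)%N.
  case: m => // -[V [gV _ _]]; rewrite II0 card_eq0 => /eqP E.
  have [V1 _ _] := gV.
  suff : (set0 : set (set G)) [set 1 * k | k in Defs.conjugate g V `&` V] by [].
  by rewrite -E; exists 1 => //; exists 1 => //; rewrite mulg1 mulgV.
rewrite /scale; apply: xget_unique => [|n [ni nm]]; first by split.
by apply/eqP; rewrite eqn_leq nm // min.
Qed.

Lemma normalised_uniscalar g U : is_subgroup U -> compact U -> open U ->
    (forall u, U u -> U (g * u * g^-1)) -> (forall u, U u -> U (g^-1 * u * g)) ->
  uniscalar g.
Proof.
move=> gU cU oU H H'; split; apply: (normalised_scale1 gU cU oU).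
  apply/seteqP; split=> [_ [u Uu <-]|u Uu]; first exact: H.
  by exists (g^-1 * u * g); [exact: H'|rewrite !mulgA mulgV mul1g mulgK].
apply/seteqP; split=> [_ [u Uu <-]|u Uu]; first by rewrite invgK; exact: H'.
by exists (g * u * g^-1); [exact: H|rewrite invgK !mulgA mulVg mul1g mulgKV].
Qed.

End ScaleOne.

Lemma finite_orbit_periodic (X : Type) (f : X -> X) (x : X) : injective f ->
  finite_set [set iter n f x | n in [set: nat]] -> exists n, iter n.+1 f x = x.
Proof.
move=> finj fin; apply: contrapT => /forallNP per; apply: infinite_nat.
have cancel_iter m n : iter m f (iter n f x) = iter m f x -> n = 0%N.
  elim: m => [|m IH]; last by move=> /finj.
  by case: n => // n /per.
have inj i j : (i <= j)%N -> iter i f x = iter j f x -> i = j.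
  move=> ij; rewrite -{1}(subnKC ij) iterD => /esym /cancel_iter /eqP ji.
  by apply/eqP; rewrite eqn_leq ij.
have -> : [set: nat] = (fun n => iter n f x) @^-1` [set iter n f x | n in [set: nat]].
  by apply/seteqP; split=> // n _; exists n.
apply: finite_preimage fin => i j _ _ e.
by case/orP: (leq_total i j) => /inj; [exact | move/(_ (esym e))].
Qed.

(** * Elliptic automorphisms *)

Section Elliptic.
Variables (d : nat) (T : regTree d).

Lemma elliptic_of_finite_orbit (g h : aut T) w : cancel h g ->
  finite_set [set iter n h w | n in [set: nat]] -> elliptic g.
Proof.
move=> gh fin; have [n per] := finite_orbit_periodic (bij_inj (aut_bij h)) fin.
exists [set iter n h w | n in [set: nat]]; split=> //; first by exists w; exists 0%N.
apply/seteqP; split=> [_ [_ [[|m] _ <-] <-]|_ [m _ <-]].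
- by exists n => //; rewrite -[in RHS]per /= gh.
- by exists m => //; rewrite /= gh.
- by exists (iter m.+1 h w); [exists m.+1 | rewrite /= gh].
Qed.

Lemma elliptic_periodic (g : aut T) : elliptic g -> exists v n, iter n.+1 g v = v.
Proof.
move=> [A [fA [v Av] gA]]; exists v.
apply: finite_orbit_periodic; first exact: bij_inj (aut_bij g).
apply: sub_finite_set fA => _ [n _ <-].
by elim: n => //= n IH; rewrite -gA; exists (iter n g v).
Qed.

End Elliptic.

(** * Uniscalar and elliptic elements of G(F, F') *)

Section Main.
Variables (d : nat) (T : regTree d) (c : colouring T).
Variables (F F' : {group 'S_d}) (sFF' : F \subset F').
Local Notation G := (G_group c sFF').
Implicit Types (B : set T) (g h : G).

(** With [y] the preimage of [v] under [g], the local action of [g * u * g^-1] at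
    [v] is that of [u] at [y], multiplied by the local actions of [g] at [u y] and
    of its inverse at [v]. If [y] is singular for [g] then [u] is the identity
    around [y] and everything cancels; otherwise [u y] is not singular either,
    since [u] fixes the singular vertices, so all factors lie in F. *)
Lemma fixator_conj B g :
    (forall v, B v -> B ((val g)^-1 v)) ->
    (forall v, local_action c (val g) v \notin F ->
      B v /\ forall a, B (nbr c v a)) ->
  forall u : G, fixator B u -> fixator B (g * u * g^-1).
Proof.
move=> gB sB u [Uu uB]; split=> [v|v Bv]; rewrite !G_valM G_valV; last first.
  by rewrite !autM uB ?autVK //; exact: gB.
rewrite !local_actionM local_actionV; set y := (val g)^-1 v.
have [sy|sy] := boolP (local_action c (val g) y \in F).
  have [suy|suy] := boolP (local_action c (val g) (val u y) \in F).
    by rewrite !groupM ?groupV.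
  have uy : val u y = y.
    apply: (bij_inj (aut_bij (val u))); apply: uB; exact: (sB _ suy).1.
  by rewrite uy sy in suy.
have [By Bny] := sB y sy.
rewrite (_ : local_action c (val u) y = 1) ?uB // ?mul1g ?mulVg //.
by apply: (@local_actionI _ _ c) => a; rewrite perm1 !uB.
Qed.

Lemma elliptic_uniscalar g : elliptic (val g) -> uniscalar g.
Proof.
move=> [A [fA [a0 Aa0] gA]]; have [_ fS] := set_mem (valP g).
have [m mP] := finite_sub_tree_ball c a0 fS.
(* radius one more than m, so as to contain the neighbours of singular vertices *)
pose B := \bigcup_(a in A) tree_ball c m.+1 a.
have fB : finite_set B by apply: bigcup_finite => // a _; exact: finite_tree_ball.
have ball_nbr n v w a : tree_ball c n v w -> tree_ball c n.+1 v (nbr c w a).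
  by move=> [s sn <-]; exists (rcons s a); rewrite /= ?size_rcons ?walk_rcons.
have gBB v : B v -> B (val g v).
  move=> [a Aa av]; exists (val g a); last exact: aut_tree_ball.
  by rewrite -gA; exists a.
have gVBB v : B v -> B ((val g)^-1 v).
  move=> [a Aa av]; exists ((val g)^-1 a); last exact: aut_tree_ball.
  by move: Aa; rewrite -{1}gA => -[a' Aa' <-]; rewrite autKV.
have SB v : local_action c (val g) v \notin F -> B v /\ forall a, B (nbr c v a).
  move=> /mP vm; split=> [|a]; exists a0 => //; last exact: ball_nbr.
  exact: sub_tree_ball vm.
apply: (@normalised_uniscalar _ g (fixator B)).
- exact: fixator_subgroup.
- by apply: fixator_compact => //; exists a0; exists a0 => //; exact: tree_ball_center.
- exact: fixator_open.
- exact: fixator_conj.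
move=> u uF; rewrite -[g in X in _ * X]invgK; apply: fixator_conj uF => v.
  by rewrite G_valV invgK; exact: gBB.
rewrite G_valV local_actionV groupV => /SB[By Bny].
split; first by rewrite -(autVK (val g) v); exact: gBB.
move=> a; rewrite -(autVK (val g) (nbr c v a)); apply: gBB.
by rewrite aut_nbr.
Qed.

(** Iterating the inclusion of [g U g^-1] in [U] bounds the orbits of the fixator
    of a ball at all the vertices [g^-n x0] by the orbit of [U] at [x0]; by
    [finite_small_orbits] there are finitely many such vertices. *)
Lemma scale1_elliptic g : distinct_point_stabilisers F -> scale g = 1%N ->
  elliptic (val g).
Proof.
move=> dF /scale1_sub[U [gU cU oU] gUg].
have [x0] := tree_nonempty T; have [U1 UM UV] := gU.
have [B fB HB] := (G_nbhsP 1 U).1 (open_nbhs_nbhs (conj oU U1)).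
have [r rP] := finite_sub_tree_ball c x0 fB.
have KU k : fix_ball c F x0 r k -> exists2 u, U u & val u = k.
  move=> [Uk kB]; pose u : U_group c F := exist _ k (mem_set Uk).
  exists (1 * Defs.incl sFF' u); last by rewrite mul1g.
  by apply: HB => v /rP /kB.
pose h : aut T := (val g)^-1.
have gK : cancel h (val g) by exact: autVK.
pose N := #|` fset_set [set val u x0 | u in U]|%fset.
apply: (elliptic_of_finite_orbit (w := x0) gK).
apply: sub_finite_set (finite_small_orbits c x0 r N dF) => _ [n _ <-].
have gUgn : forall u, U u -> exists2 u', U u' & forall v,
    iter n (val g) (val u (iter n h v)) = val u' v.
  elim: n => [|n IH] u Uu; first by exists u.
  have : U (g * u * g^-1) by apply: gUg; exists u.
  move=> /IH[u' Uu' e]; exists u' => // v.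
  by rewrite -e iterSr iterS !G_valM G_valV.
have cancelg v : iter n h (iter n (val g) v) = v.
  by elim: n v {gUgn} => // n IH v; rewrite iterSr iterS autKV IH.
apply: (@card_fset_set_image _ _ (iter n h)); first exact: finite_compact_orbit.
move=> _ [k /KU[u Uu <-] <-]; have [u' Uu' e] := gUgn u Uu.
by exists (val u' x0); [exists u' | rewrite -e cancelg].
Qed.

Lemma fix_nbr (u : aut T) y a b : U_set c F u -> 'C_F[a | 'P] \subset 'C_F[b | 'P] ->
  u y = y -> u (nbr c y a) = nbr c y a -> u (nbr c y b) = nbr c y b.
Proof.
move=> Uu sab uy; rewrite !aut_nbr uy => /nbr_inj ua.
have : local_action c u y \in 'C_F[b | 'P].
  by apply: (fintype.subsetP sab); rewrite mem_stab Uu ua eqxx.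
by rewrite mem_stab => /andP[_ /eqP ->].
Qed.

(** The translation takes [x0] to [x2] and has trivial local actions. Its power
    [n.+1] takes [x0] to the end of the reduced word (ab)^(n+1), so it fixes no
    vertex: a power with trivial local actions that fixes a vertex is trivial. The
    translation maps the edge from [x0] to [x1] to the edge from [x2] to [x3], and by [fix_nbr]
    an element of U(F) fixing one of the two edges fixes the other as well. *)
Lemma uniscalar_translation a b : a != b -> 'C_F[a | 'P] = 'C_F[b | 'P] ->
  exists g, uniscalar g /\ ~ elliptic (val g).
Proof.
move=> ab Fab; have [x0] := tree_nonempty T.
pose x1 := nbr c x0 a; pose x2 := nbr c x1 b; pose x3 := nbr c x2 a.
have [t [t0 t1 tb]] := @branch_aut _ _ c x0 x2 1 (fun=> 1) (fun=> erefl).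
have tU v : local_action c t v = 1.
  rewrite -(walk_word c x0 v); have := word_reduced c x0 v.
  by case: word => // e s /tb[].
have tnbr v e : t (nbr c v e) = nbr c (t v) e by rewrite aut_nbr tU perm1.
have twalk v s : t (walk c v s) = walk c (t v) s.
  by elim: s v => //= e s IH v; rewrite IH tnbr.
have tUF : U_set c F t by move=> v; rewrite tU group1.
have tG : t \in G_set c F F'.
  exact: (U_sub_G sFF' (exist _ t (mem_set tUF) : U_group c F)).
pose g : G := exist _ t tG.
exists g; split; last first.
  move=> /elliptic_periodic[v [n]] per.
  have iwalk m w s : iter m t (walk c w s) = walk c (iter m t w) s.
    by elim: m => // m IH; rewrite !iterS IH twalk.
  have : iter n.+1 t x0 = x0.
    by rewrite -(walk_word c v x0) iwalk per.
  pose w m := iter m (fun s => [:: a, b & s]) [::].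
  have -> : iter n.+1 t x0 = walk c x0 (w n.+1).
    by elim: n.+1 => // m IH; rewrite iterS IH twalk t0.
  have wr m : path (fun a b => a != b) b (w m).
    by elim: m => //= m ->; rewrite eq_sym ab.
  by move/reduced_closed; rewrite /reduced /= ab wr => /(_ isT).
have [tx0 tx1] : t x0 = x2 /\ t x1 = x3 by rewrite tnbr t0.
pose B := [set x0; x1].
have fB : finite_set B by rewrite finite_setU; split; exact: finite_set1.
(* fixing one edge of the axis amounts to fixing the next edge of its colour *)
have slide u : U_set c F u -> u x0 = x0 /\ u x1 = x1 <-> u x2 = x2 /\ u x3 = x3.
  move=> Uu; have x10 : x0 = nbr c x1 a by rewrite nbrK.
  have x21 : x1 = nbr c x2 b by rewrite nbrK.
  have sab : 'C_F[a | 'P] \subset 'C_F[b | 'P] by rewrite Fab.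
  have sba : 'C_F[b | 'P] \subset 'C_F[a | 'P] by rewrite Fab.
  split=> -[e e'].
    have e2 : u x2 = x2 by apply: (fix_nbr Uu sab) => //; rewrite -x10.
    by split=> //; apply: (fix_nbr Uu sba) => //; rewrite -x21.
  have e1 : u x1 = x1 by rewrite x21; apply: (fix_nbr Uu sab).
  by split=> //; rewrite x10; apply: (fix_nbr Uu sba).
apply: (@normalised_uniscalar _ g (fixator B)).
- exact: fixator_subgroup.
- by apply: fixator_compact => //; exists x0; left.
- exact: fixator_open.
- move=> u [Uu uB].
  have Uc : U_set c F (val (g * u * g^-1)).
    move=> v; rewrite !G_valM G_valV !local_actionM local_actionV.
    by rewrite !groupM ?groupV //; exact: tUF.
  split=> //; have [] := (slide _ Uc).2; last by move=> e0 e1 v [->|->].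
  rewrite -tx0 -tx1 !G_valM G_valV !autM !autKV.
  by rewrite !uB; [|right|left].
move=> u [Uu uB].
have Uc : U_set c F (val (g^-1 * u * g)).
  move=> v; rewrite !G_valM G_valV !local_actionM local_actionV.
  by rewrite !groupM ?groupV //; exact: tUF.
have [e2 e3] : val u x2 = x2 /\ val u x3 = x3.
  by apply/(slide _ Uu).1; split; apply: uB; [left|right].
split=> // v [->|->]; rewrite !G_valM G_valV !autM.
  by rewrite [val g x0]tx0 e2 -tx0 autKV.
by rewrite [val g x1]tx1 e3 -tx1 autKV.
Qed.

End Main.

Theorem corollary3p23 (d : nat) (T : regTree d) (c : colouring T)
    (F F' : {group 'S_d}) (sFF' : F \subset F') :
  distinct_point_stabilisers F <->
  [set g : G_group c sFF' | uniscalar g] = [set g : G_group c sFF' | elliptic (val g)].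
Proof.
split=> [dF|UE a b].
  apply/seteqP; split=> g; last exact: elliptic_uniscalar.
  by move=> [g1 _]; exact: scale1_elliptic dF g1.
split=> [Fab|-> //]; apply/eqP/negPn/negP => ab.
have [g [gu]] := uniscalar_translation c sFF' ab Fab; apply.
by have : [set g : G_group c sFF' | uniscalar g] g by []; rewrite UE.
Qed.
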